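(* Let $\mathbf{G}=(G,\alpha,w)$ and $\mathbf{G}'=(G',\alpha',w')$ be finite MW-graphs where $\mathbf{G}'=\mathbf{G}-e_0$ for some edge $e_0$ of $G=(V,E,\partial)$, i.e. $G'=G-e_0$ and $\alpha'$ is the restriction of $\alpha$ (no relation between $w$ and $w'$ is assumed a priori). 1. Suppose $w'_e\le w_e$ for all edges $e\neq e_0$ (i.e. all $e\in E(G')$) and $w(v)\le w'(v)$ for all $v\in V\setminus\{\partial_-e_0,\partial_+e_0\}$. Then: (a) if $w(v)\le w'(v)$ for $v\in\{\partial_-e_0,\partial_+e_0\}$, then $\mathbf{G}'\sqsubseteq\mathbf{G}$ (and hence $\mathbf{G}'\preccurlyeq\mathbf{G}$); (b) if $w(v)-w_{e_0}\le w'(v)$ for $v\in\{\partial_-e_0,\partial_+e_0\}$ and $\varrho_\infty\le1$, then $\mathbf{G}'\stackrel{1}{\preccurlyeq}\mathbf{G}$. Moreover, if in addition $e_0$ is a loop and $\alpha_{e_0}=\pi$, then $\mathbf{G}'\preccurlyeq\mathbf{G}$. 2. If $w_e\le w'_e$ for all edges $e\neq e_0$ and $w'(v)\le w(v)$ for all $v\in V$, then $\mathbf{G}\stackrel{1}{\preccurlyeq}\mathbf{G}'$. Moreover, if in addition $e_0$ is a loop with $\alpha_{e_0}=0$, then $\mathbf{G}\preccurlyeq\mathbf{G}'$. 3. If $w_e=w'_e$ for all edges $e\neq e_0$, $w'(v)=w(v)$ for all $v\in V$, and $e_0$ is a loop with $\alpha_{e_0}=0$, then $\mathbf{G}'\preccurlyeq\mathbf{G}\preccurlyeq\mathbf{G}'$,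 i.e. $\mathbf{G}$ and $\mathbf{G}'$ are isospectral.
   Context: Graphs: a graph $G=(V,E,\partial)$ consists of disjoint sets $V$ (vertices) and $E$ (edges), a map $\partial\colon E\to V\times V$, $\partial e=(\partial_-e,\partial_+e)$, and an involution $e\mapsto\bar e$ on $E$ with $e\neq\bar e$ and $\partial_\pm\bar e=\partial_\mp e$. Loops ($\partial_-e=\partial_+e$) and multiple edges are allowed; $G$ need not be connected. $E_v=\{e\in E:\partial_-e=v\}$, $\deg(v)=|E_v|<\infty$. Deleting the edge $e_0$ means removing both $e_0$ and $\bar e_0$: $G-e_0=(V,E\setminus\{e_0,\bar e_0\},\partial)$; ''all edges $e\ne e_0$'' means all $e\in E\setminus\{e_0,\bar e_0\}$. MW-graphs: a weight $w$ consists of $w\colon V\to(0,\infty)$, $w\colon E\to(0,\infty)$ with $w_{\bar e}=w_e$. Fix a subgroup $R$ of $\mathbb{R}/2\pi\mathbb{Z}$; a magnetic potential is $\alpha\colon E\to R$ with $\alpha_{\bar e}=-\alpha_e$. An MW-graph is $\mathbf{G}=(G,\alpha,w)$; finite means $V$ finite, $|\mathbf{G}|=|V|$. The maximal relative weight of $\mathbf{G}$ is $\varrho_\infty=\sup_{v\in V}\frac1{w(v)}\sum_{e\in E_v}w_e$ (here of $\mathbf{G}$, not $\mathbf{G}'$). $\mathbf{G}\sqsubseteq\mathbf{G}'$ means that there is an MW-homomorphism $\pi\colon\mathbf{G}\to\mathbf{G}'$, i.e. maps $\pi\colon V\to V'$, $\pi\colon E\to E'$ with $\pi(\partial_\pm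 e)=\partial'_\pm(\pi e)$, $\alpha_e=\alpha'_{\pi e}$ for all $e\in E$, $\sum_{\pi(v)=v'}w(v)\ge w'(v')$ for all $v'\in V'$, and $\sum_{\pi(e)=e'}w_e\le w'_{e'}$ for all $e'\in E'$. Spectral preorder: $\lambda_1(\mathbf{G})\le\dots\le\lambda_{|\mathbf{G}|}(\mathbf{G})$ are the eigenvalues, with multiplicity, of the magnetic Laplacian $(\Delta_\alpha\varphi)(v)=\frac1{w(v)}\sum_{e\in E_v}w_e\bigl(\varphi(v)-\mathrm{e}^{\mathrm{i}\alpha_e}\varphi(\partial_+e)\bigr)$, self-adjoint on $\ell_2(V,w)$. For $r\in\mathbb{N}_0$, $\mathbf{G}\stackrel{r}{\preccurlyeq}\mathbf{G}'$ means $|\mathbf{G}|\ge|\mathbf{G}'|-r$ and $\lambda_k(\mathbf{G})\le\lambda_{k+r}(\mathbf{G}')$ for all $1\le k\le|\mathbf{G}'|-r$; $\preccurlyeq$ means $\stackrel{0}{\preccurlyeq}$. *)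

(* Defs.v *)
From HB Require Import structures.
From mathcomp Require Import all_boot all_order all_algebra.
From mathcomp Require Import generic_quotient ring_quotient.
From mathcomp Require Import all_classical all_reals all_analysis.
From mathcomp Require Import complex.

Set Implicit Arguments.
Unset Strict Implicit.
Unset Printing Implicit Defensive.

Import Order.TTheory GRing.Theory Num.Theory.

Local Open Scope ring_scope.

Definition two_pi_Z (R : realType) : {pred R} :=
  [pred x : R | `[< exists k : int, x = (pi *+ 2) *~ k >]].

Lemma two_pi_Z_zmod_closed (R : realType) : zmod_closed (@two_pi_Z R).
Proof.
split=> [|_ _ /asboolP[k ->] /asboolP[l ->]]; apply/asboolP.
  by exists 0; rewrite mulr0z.
by exists (k - l); rewrite mulrzBr.
Qed.

HB.instance Definition _ (R : realType) :=
  GRing.isZmodClosed.Build R (@two_pi_Z R) (@two_pi_Z_zmod_closed R).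

Definition angle (R : realType) : zmodType :=
  Quotient.quot (@two_pi_Z R : zmodClosed R).

Definition to_angle (R : realType) (x : R) : angle R :=
  \pi_(Quotient.quot (@two_pi_Z R : zmodClosed R))%qT x.

(* [exp(i t)], through a chosen real representative of [t]; the choice is
   irrelevant by [expi_to_angle]. *)
Definition expi (R : realType) (t : angle R) : R[i] :=
  let x : R := repr (t : Quotient.quot (@two_pi_Z R : zmodClosed R)) in
  Complex (cos x) (sin x).

Lemma to_angle_eq (R : realType) (x y : R) :
  to_angle x = to_angle y <-> exists k : int, x - y = (pi *+ 2) *~ k.
Proof.
split=> [/eqP|xy]; last apply/eqP.
  by rewrite -Quotient.idealrBE => /asboolP.
by rewrite -Quotient.idealrBE; apply/asboolP.
Qed.

Lemma to_angleD (R : realType) : {morph @to_angle R : x y / x + y}.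
Proof. by move=> x y; rewrite /to_angle Quotient.pi_add. Qed.

Lemma to_angleN (R : realType) : {morph @to_angle R : x / - x}.
Proof. by move=> x; rewrite /to_angle Quotient.pi_opp. Qed.

Lemma expi_to_angle (R : realType) (x : R) :
  expi (to_angle x) = Complex (cos x) (sin x).
Proof.
rewrite /expi; set y : R := repr _.
have /to_angle_eq[k xy] : to_angle y = to_angle x by exact: reprK.
have -> : y = x + (pi *+ 2) *~ k by rewrite -xy addrC subrK.
have per (f : R -> R) : periodic f (pi *+ 2) ->
    forall (l : int) a, f (a + (pi *+ 2) *~ l) = f a.
  move=> fP [] n a; first by rewrite -pmulrn periodicn.
  by rewrite NegzE mulrNz -pmulrn -(periodicn fP n.+1) subrK.
by rewrite !per //; [exact: sinD2pi|exact: cosD2pi].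
Qed.

Lemma conj_realc (R : realType) (x : R) : (x%:C%C)^* = x%:C%C.
Proof. exact: conjc_real. Qed.

Lemma expiN (R : realType) (t : angle R) : expi (- t) = (expi t)^*.
Proof.
have <- : to_angle (repr (t : Quotient.quot (@two_pi_Z R : zmodClosed R))) = t.
  exact: reprK.
by rewrite -to_angleN !expi_to_angle cosN sinN.
Qed.

(* Finite graphs only: a graph with finitely many vertices, all of finite
   degree, has finitely many edges, since [edge] is the disjoint union of the
   sets [E_v]. *)
Record graph := Graph {
  vertex : finType;
  edge : finType;
  bd : edge -> vertex * vertex;
  ebar : edge -> edge;
  ebarK : involutive ebar;
  ebar_neq : forall e, e != ebar e;
  bd_ebar : forall e, bd (ebar e) = ((bd e).2, (bd e).1)
}.

Definition bdm (G : graph) (e : edge G) : vertex G := (bd e).1.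
Definition bdp (G : graph) (e : edge G) : vertex G := (bd e).2.

Definition is_loop (G : graph) (e : edge G) : Prop := bdm e = bdp e.

Section DeleteEdge.
Variables (G : graph) (e0 : edge G).

Definition kept_edge : finType := {e : edge G | e \notin [:: e0; ebar e0]}.

Lemma kept_ebar (e : kept_edge) : ebar (val e) \notin [:: e0; ebar e0].
Proof.
case: e => e /=; rewrite !inE !negb_or => /andP[ne ne'].
by rewrite -[X in ebar e != X]ebarK !(inj_eq (can_inj (@ebarK G))) ne ne'.
Qed.

Definition kept_bar (e : kept_edge) : kept_edge :=
  exist _ (ebar (val e)) (kept_ebar e).

Lemma kept_ebarK : involutive kept_bar.
Proof. by move=> e; apply: val_inj; rewrite /= ebarK. Qed.

Lemma kept_ebar_neq (e : kept_edge) : e != kept_bar e.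
Proof. by rewrite -(inj_eq val_inj) /= ebar_neq. Qed.

Lemma kept_bd_ebar (e : kept_edge) :
  bd (val (kept_bar e)) = ((bd (val e)).2, (bd (val e)).1).
Proof. exact: bd_ebar. Qed.

Definition del_edge : graph :=
  @Graph (vertex G) kept_edge (fun e => bd (val e))
    kept_bar kept_ebarK kept_ebar_neq kept_bd_ebar.

Definition old_edge (e : edge del_edge) : edge G := val (e : kept_edge).

End DeleteEdge.

Record weight (R : realType) (G : graph) := Weight {
  wV : vertex G -> R;
  wE : edge G -> R;
  wV_gt0 : forall v, 0 < wV v;
  wE_gt0 : forall e, 0 < wE e;
  wE_ebar : forall e, wE (ebar e) = wE e
}.

Record potential (R : realType) (S : zmodClosed (angle R)) (G : graph) :=
  Potential {
    pot : edge G -> angle R;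
    pot_in : forall e, pot e \in S;
    pot_ebar : forall e, pot (ebar e) = - pot e
  }.

Definition del_potential (R : realType) (S : zmodClosed (angle R)) (G : graph)
    (a : potential S G) (e0 : edge G) : potential S (del_edge e0) :=
  @Potential R S (del_edge e0) (fun e => pot a (old_edge e))
    (fun e => pot_in a (old_edge e)) (fun e => pot_ebar a (old_edge e)).

Record mwgraph (R : realType) (S : zmodClosed (angle R)) := MWGraph {
  mwG : graph;
  mwA : potential S mwG;
  mwW : weight R mwG
}.

Definition order_mw (R : realType) (S : zmodClosed (angle R))
  (G : mwgraph S) : nat := #|vertex (mwG G)|.

Definition max_rel_weight (R : realType) (G : graph) (w : weight R G) : R :=
  sup (range (fun v => (wV w v)^-1 * \sum_(e | bdm e == v) wE w e)).

(* Compatibility of [piE] with the involutions [ebar] is not required. *)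
Record is_mw_hom (R : realType) (S : zmodClosed (angle R)) (G G' : mwgraph S)
    (piV : vertex (mwG G) -> vertex (mwG G'))
    (piE : edge (mwG G) -> edge (mwG G')) : Prop := {
  mw_hom_bdm : forall e, piV (bdm e) = bdm (piE e);
  mw_hom_bdp : forall e, piV (bdp e) = bdp (piE e);
  mw_hom_pot : forall e, pot (mwA G) e = pot (mwA G') (piE e);
  mw_hom_wV : forall v', wV (mwW G') v' <= \sum_(v | piV v == v') wV (mwW G) v;
  mw_hom_wE : forall e', \sum_(e | piE e == e') wE (mwW G) e <= wE (mwW G') e'
}.

Definition mw_sub (R : realType) (S : zmodClosed (angle R))
    (G G' : mwgraph S) : Prop :=
  exists piV piE, @is_mw_hom R S G G' piV piE.

Definition laplacian (R : realType) (S : zmodClosed (angle R)) (G : mwgraph S)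
    (f : vertex (mwG G) -> R[i]) (v : vertex (mwG G)) : R[i] :=
  ((wV (mwW G) v)^-1)%:C%C *
  \sum_(e | bdm e == v)
    (wE (mwW G) e)%:C%C * (f v - expi (pot (mwA G) e) * f (bdp e)).

(* The matrix in the standard basis of [C^V], numbered by [enum_val]. *)
Definition laplacian_mx (R : realType) (S : zmodClosed (angle R))
    (G : mwgraph S) : 'M[R[i]]_(order_mw G) :=
  \matrix_(i, j) laplacian (fun u => (u == enum_val j)%:R) (enum_val i).

(* The roots of the characteristic polynomial, repeated according to their
   multiplicity. *)
Definition complex_spectrum (R : realType) (S : zmodClosed (angle R))
    (G : mwgraph S) : seq R[i] :=
  sval (closed_field_poly_normal (char_poly (laplacian_mx G))).

(* Nothing is lost by taking real parts: see [complex_spectrum_real]. *)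
Definition spectrum (R : realType) (S : zmodClosed (angle R))
    (G : mwgraph S) : seq R :=
  sort <=%O [seq complex.Re z | z <- complex_spectrum G].

(* [lambda G k] is the [k]-th smallest eigenvalue, counting from 1. *)
Definition lambda (R : realType) (S : zmodClosed (angle R))
    (G : mwgraph S) (k : nat) : R := nth 0 (spectrum G) k.-1.

Definition spec_le (R : realType) (S : zmodClosed (angle R)) (r : nat)
    (G G' : mwgraph S) : Prop :=
  (order_mw G' - r <= order_mw G)%N /\
  forall k : nat, (1 <= k <= order_mw G' - r)%N ->
    lambda G k <= lambda G' (k + r).

Definition isospectral (R : realType) (S : zmodClosed (angle R))
    (G G' : mwgraph S) : Prop := spectrum G = spectrum G'.

Section SelfAdjoint.
Variables (R : realType) (S : zmodClosed (angle R)) (G : mwgraph S).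
Local Notation V := (vertex (mwG G)).
Local Notation C := R[i].

Definition inner_w (f g : V -> C) : C :=
  \sum_v (wV (mwW G) v)%:C%C * (f v * (g v)^*).

Lemma laplacianE (f : V -> C) v :
  (wV (mwW G) v)%:C%C * laplacian f v =
  \sum_(e | bdm e == v)
    (wE (mwW G) e)%:C%C * (f v - expi (pot (mwA G) e) * f (bdp e)).
Proof.
rewrite /laplacian mulrA -rmorphM /= divff ?gt_eqF ?wV_gt0 //.
by rewrite rmorph1 mul1r.
Qed.

Lemma laplacian_mxE (x : 'cV[C]_(order_mw G)) (i : 'I_(order_mw G)) :
  (laplacian_mx G *m x) i 0 =
  laplacian (fun u => x (enum_rank u) 0) (enum_val i).
Proof.
have lin (f : V -> C) : f =1 fun u => \sum_(j < order_mw G) (u == enum_val j)%:R * f (enum_val j).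
  move=> u /=; rewrite (bigD1 (enum_rank u)) //= enum_rankK eqxx mul1r big1 ?addr0//.
  move=> j ju; case: eqVneq => [uj|]; last by rewrite mul0r.
  by rewrite uj enum_valK eqxx in ju.
rewrite mxE /laplacian [RHS]mulr_sumr.
under eq_bigr => j _ do rewrite mxE /laplacian -mulrA mulr_suml mulr_sumr.
rewrite exchange_big /=; apply: eq_bigr => e _.
rewrite -mulr_sumr; congr (_ * _).
under eq_bigr => j _ do rewrite -mulrA mulrBl -mulrA.
rewrite -mulr_sumr sumrB -mulr_sumr; congr (_ * (_ - _ * _)).
  by rewrite [RHS](lin (fun u => x (enum_rank u) 0)); apply: eq_bigr => j _; rewrite enum_valK.
by rewrite [RHS](lin (fun u => x (enum_rank u) 0)); apply: eq_bigr => j _; rewrite enum_valK.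
Qed.

Lemma laplacian_self_adjoint (f g : V -> C) :
  inner_w (laplacian f) g = inner_w f (laplacian g).
Proof.
rewrite /inner_w.
under eq_bigr => v _ do rewrite mulrA laplacianE.
under [RHS]eq_bigr => v _.
  rewrite mulrCA -[X in X * (laplacian g v)^*]conj_realc -rmorphM laplacianE.
  over.
transitivity (\sum_e (wE (mwW G) e)%:C%C * (f (bdm e) - expi (pot (mwA G) e) * f (bdp e)) * (g (bdm e))^*).
  rewrite (partition_big (@bdm (mwG G)) xpredT) //=; apply: eq_bigr => v _.
  by rewrite mulr_suml; apply: eq_bigr => e /eqP ->.
transitivity (\sum_e f (bdm e) * ((wE (mwW G) e)%:C%C * (g (bdm e) - expi (pot (mwA G) e) * g (bdp e)))^*); last first.
  rewrite [LHS](partition_big (@bdm (mwG G)) xpredT) //=; apply: eq_bigr => v _.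
  by rewrite rmorph_sum mulr_sumr; apply: eq_bigr => e /eqP ->.
under eq_bigr => e _ do rewrite mulrBr mulrBl.
under [RHS]eq_bigr => e _ do rewrite rmorphM rmorphB rmorphM /= mulrBr mulrBr conj_realc.
rewrite !sumrB; congr (_ - _).
  by apply: eq_bigr => e _; rewrite mulrCA !mulrA.
rewrite [LHS](reindex_inj (can_inj (@ebarK (mwG G)))) /=.
apply: eq_bigr => e _.
rewrite wE_ebar /bdm /bdp bd_ebar /= pot_ebar expiN.
by rewrite -!mulrA [RHS]mulrCA; congr (_ * _); rewrite mulrCA.
Qed.

Lemma size_complex_spectrum : size (complex_spectrum G) = order_mw G.
Proof.
rewrite /complex_spectrum; case: closed_field_poly_normal => s /= ps.
have := size_char_poly (laplacian_mx G).
rewrite ps (monicP (char_poly_monic _)) scale1r size_prod_XsubC.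
by case.
Qed.

Lemma size_spectrum : size (spectrum G) = order_mw G.
Proof. by rewrite size_sort size_map size_complex_spectrum. Qed.

Lemma complex_spectrum_real (z : C) :
  z \in complex_spectrum G -> z = (complex.Re z)%:C%C.
Proof.
rewrite /complex_spectrum; case: closed_field_poly_normal => s /= ps zs.
have : root (char_poly (laplacian_mx G)^T) z.
  rewrite /char_poly -det_tr /char_poly_mx linearB /= tr_scalar_mx map_trmx.
  rewrite trmxK -/(char_poly_mx _) -/(char_poly _) ps (monicP (char_poly_monic _)) scale1r.
  by rewrite root_prod_XsubC.
rewrite -eigenvalue_root_char => /eigenvalueP[y /(congr1 trmx)].
rewrite trmx_mul trmxK linearZ /= => yz y0.
set f : V -> C := fun u => y^T (enum_rank u) 0.
have fz v : laplacian f v = z * f v.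
  have /matrixP/(_ (enum_rank v) 0) := yz.
  by rewrite laplacian_mxE enum_rankK mxE.
have : inner_w (laplacian f) f = inner_w f (laplacian f).
  exact: laplacian_self_adjoint.
rewrite /inner_w.
under eq_bigr => v _ do rewrite fz -(mulrA z) mulrCA.
have -> : \sum_v (wV (mwW G) v)%:C%C * (f v * (laplacian f v)^*) =
    z^* * \sum_v (wV (mwW G) v)%:C%C * (f v * (f v)^*).
  rewrite mulr_sumr; apply: eq_bigr => v _.
  by rewrite fz rmorphM /= [X in _ * X]mulrCA [LHS]mulrCA.
rewrite -mulr_sumr => /mulIf zz.
have {zz} : z = z^*.
  apply: zz; apply: contra_neq y0 => /eqP.
  have w0 v : 0 < (wV (mwW G) v)%:C%C by rewrite -[X in X < _]/((0 : R)%:C%C) ltcR wV_gt0.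
  rewrite psumr_eq0; last by move=> v _; rewrite mulr_ge0 ?mul_conjC_ge0// ltW.
  move=> /allP f0; apply/rowP => i; rewrite mxE.
  have := f0 (enum_val i) (mem_index_enum _).
  by rewrite mulf_eq0 gt_eqF //= mul_conjC_eq0 /f enum_valK mxE => /eqP.
case: z {zs yz fz} => a b [] /eqP; rewrite -addr_eq0 -mulr2n mulrn_eq0 /=.
by move=> /eqP ->.
Qed.

End SelfAdjoint.

(* Main.v *)
Require Import Defs.
From mathcomp Require Import all_boot all_order all_algebra.
From mathcomp Require Import all_classical all_reals all_analysis.
From mathcomp Require Import perm complex ring lra zify.

Import Order.TTheory GRing.Theory Num.Theory.
Local Open Scope ring_scope.
Set Implicit Arguments.
Unset Strict Implicit.
Unset Printing Implicit Defensive.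

(** The magnetic Laplacian is the operator of the quadratic form
    q(f) = 1/2 sum_e w_e |f(e-) - exp(i alpha_e) f(e+)|^2 ([energy]) relative
    to the norm N(f) = sum_v w(v) |f(v)|^2 ([mass]).  By the spectral theorem
    both forms are simultaneously diagonal, with the eigenvalues as quotients
    ([laplacian_diagonalization]); a dimension count then gives the
    Courant-Fischer comparison in the following form ([minmax_comparison],
    [spec_le_of_forms]): if, on the functions cut out by r linear conditions
    and for each eigenvalue mu of G', the inequality q' <= mu N' implies
    q <= mu N, then lambda_k(G) <= lambda_(k+r)(G').

    Deleting e0, with endpoints u and v, removes from q exactly the term
    w_e0 |f(u) - z f(v)|^2 where z = exp(i alpha_e0) ([energy_del]).  So:

    - deletion lowers q, and enlarging the vertex weights raises N; as the
      eigenvalues are nonnegative this lowers the spectrum ([spec_le_del]);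
    - on the functions with f(u) = z f(v), deletion does not lower q, which
      yields the reverse comparison with one linear condition
      ([spec_le_del_sym]);
    - on the functions with f(u) = - z f(v), deletion lowers q by at
      least 4 w_e0 |f(u)|^2, while lowering the weights of the endpoints by w_e0
      lowers N by at most 2 w_e0 |f(u)|^2.  The loss in q makes up for
      the loss in N as long as mu <= 2, and all eigenvalues are at most twice
      the maximal relative weight ([spec_le_del_antisym]).

    On a loop the condition f(u) = z f(v) is void when alpha_e0 = 0, and
    f(u) = - z f(v) is void when alpha_e0 = pi, so no shift is needed there. *)

(** * Squared moduli, as real numbers *)

Definition sqmod (R : realType) (z : R[i]) : R :=
  complex.Re z ^+ 2 + complex.Im z ^+ 2.

Lemma sqmodE (R : realType) (z : R[i]) : (sqmod z)%:C%C = z * z^*.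
Proof.
case: z => x y; rewrite /sqmod /=; apply/eqP; rewrite eq_complex /=.
by apply/andP; split; apply/eqP; ring.
Qed.

Lemma sqmod_ge0 (R : realType) (z : R[i]) : 0 <= sqmod z.
Proof. by rewrite addr_ge0 ?sqr_ge0. Qed.

Lemma sqmod_eq0 (R : realType) (z : R[i]) : (sqmod z == 0) = (z == 0).
Proof.
by rewrite /sqmod paddr_eq0 ?sqr_ge0// !sqrf_eq0 eq_complex.
Qed.

Lemma sqmodM (R : realType) (y z : R[i]) : sqmod (y * z) = sqmod y * sqmod z.
Proof. by case: y z => a b [c d]; rewrite /sqmod /=; ring. Qed.

Lemma sqmodN (R : realType) (z : R[i]) : sqmod (- z) = sqmod z.
Proof. by case: z => a b; rewrite /sqmod /=; ring. Qed.

Lemma sqmod_conj (R : realType) (z : R[i]) : sqmod z^* = sqmod z.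
Proof. by case: z => a b; rewrite /sqmod /=; ring. Qed.

Lemma sqmodB_le (R : realType) (y z : R[i]) :
  sqmod (y - z) <= 2 * (sqmod y + sqmod z).
Proof.
case: y z => a b [c d]; rewrite /sqmod /=.
have := sqr_ge0 (a + c); have := sqr_ge0 (b + d); nra.
Qed.

Lemma sqmod_expi (R : realType) (t : angle R) : sqmod (expi t) = 1.
Proof. exact: cos2Dsin2. Qed.

Lemma expi_mul_conj (R : realType) (t : angle R) : expi t * (expi t)^* = 1.
Proof. by rewrite -sqmodE sqmod_expi. Qed.

(** * Linear algebra *)

Lemma exists_annihilated (F : fieldType) (m n : nat) (M : 'M[F]_(m, n)) :
  (m < n)%N -> exists2 x : 'cV[F]_n, x != 0 & M *m x = 0.
Proof.
move=> mn; have : kermx M^T != 0.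
  rewrite -mxrank_eq0 mxrank_ker mxrank_tr subn_eq0 -ltnNge.
  exact: leq_ltn_trans (rank_leq_row M) mn.
case/rowV0Pn => y yM y0; exists y^T; first by rewrite trmx_eq0.
apply: trmx_inj; rewrite trmx_mul trmxK trmx0.
by apply/eqP; rewrite -sub_kermx.
Qed.

Lemma char_poly_similar (F : fieldType) n (P A : 'M[F]_n) : P \in unitmx ->
  char_poly (invmx P *m A *m P) = char_poly A.
Proof.
move=> Pu; rewrite /char_poly.
have -> : char_poly_mx (invmx P *m A *m P) =
    map_mx polyC (invmx P) *m char_poly_mx A *m map_mx polyC P.
  rewrite /char_poly_mx mulmxBr mulmxBl !map_mxM /=; congr (_ - _).
  by rewrite scalar_mxC -mulmxA -map_mxM mulVmx// map_mx1 mulmx1.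
rewrite !det_mulmx mulrAC -det_mulmx -map_mxM mulVmx//.
by rewrite map_mx1 det1 mul1r.
Qed.

(** A matrix that is self-adjoint for the weights [d ^ 2] is conjugate by
    [diag_mx d] to a Hermitian one; [Q] is the unitary diagonalization of the
    latter times [diag_mx d], so that it diagonalizes the weights and the form
    of [A] at once. *)
Lemma weighted_spectral (C : numClosedFieldType) n (A : 'M[C]_n) (d : 'rV[C]_n) :
  (forall i, 0 < d 0 i) ->
  (forall i j, d 0 i ^+ 2 * A i j = (d 0 j ^+ 2 * A j i)^*) ->
  exists Q : 'M[C]_n, exists sp : 'rV[C]_n,
    [/\ char_poly A = \prod_(i < n) ('X - (sp 0 i)%:P),
        map_mx Num.conj Q^T *m Q = diag_mx (\row_i d 0 i ^+ 2) &
        map_mx Num.conj Q^T *m diag_mx sp *m Q = diag_mx (\row_i d 0 i ^+ 2) *m A].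
Proof.
move=> d_gt0 sym; pose D := diag_mx d; pose D' := diag_mx (\row_i (d 0 i)^-1).
have dconj i : (d 0 i)^* = d 0 i by apply: conj_Creal; rewrite gtr0_real.
have d0 i : d 0 i != 0 by rewrite gt_eqF.
have DD' : D' *m D = 1%:M.
  apply/matrixP => i j; rewrite mul_diag_mx !mxE; case: eqP => [->|_].
    by rewrite mulVf.
  by rewrite mulr0.
have [D'u Du] := mulmx1_unit DD'.
have invD : invmx D = D' by rewrite -[LHS]mul1mx -DD' mulmxK.
have D2 : D *m D = diag_mx (\row_i d 0 i ^+ 2).
  by rewrite mulmx_diag; congr diag_mx; apply/rowP => i; rewrite !mxE.
have Dadj : map_mx Num.conj D^T = D.
  rewrite tr_diag_mx map_diag_mx; congr diag_mx; apply/rowP => i.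
  by rewrite mxE; exact: dconj.
pose H := D *m A *m D'.
have HE i j : H i j = d 0 i * A i j / d 0 j.
  by rewrite /H mul_mx_diag mxE mul_diag_mx !mxE.
have Hherm : H \is hermsymmx.
  apply/is_hermitianmxP; rewrite expr0 scale1r; apply/matrixP => i j.
  rewrite [RHS]mxE [in RHS]mxE !HE.
  transitivity ((d 0 j * A j i / d 0 i)^*); last by [].
  rewrite !rmorphM /= fmorphV /= !dconj.
  apply: (mulfI (d0 i)); apply: (mulIf (d0 j)).
  have := sym i j; rewrite rmorphM rmorphXn /= dconj => symij.
  transitivity (d 0 i ^+ 2 * A i j); first by field.
  by rewrite symij; field.
have /orthomx_spectralP := hermitian_normalmx Hherm.
set P := spectralmx H; set sp := spectral_diag H => HP.
have PU : P \is unitarymx by exact: spectral_unitarymx.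
have Pu := unitarymx_unit PU.
exists (P *m D), sp; split.
- have -> : char_poly A = char_poly H.
    by rewrite -(char_poly_similar A D'u) /H -invD invmxK.
  rewrite HP char_poly_similar// char_poly_trig ?diag_mx_is_trig//.
  by apply: eq_bigr => i _; rewrite mxE eqxx.
- rewrite trmx_mul map_mxM Dadj -invmx_unitary// !mulmxA mulmxKV//.
- rewrite trmx_mul map_mxM Dadj -invmx_unitary// -!mulmxA.
  rewrite [diag_mx sp *m _]mulmxA [invmx P *m _]mulmxA [invmx P *m _]mulmxA -HP.
  by rewrite -D2 /H -!mulmxA DD' mulmx1.
Qed.

(** * The min-max comparison *)

Section MinMax.
Variable R : realType.
Local Notation C := R[i].

(** A spectral decomposition stated through quadratic forms: when [N] is positive
    definite, the rows of [Q] are the coordinate forms of an [N]-orthonormal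
    basis in which [q] is diagonal. *)
Definition diagonalizes n (Q : 'M[C]_n) (s : seq R) (N q : 'cV[C]_n -> R) :=
  forall x, N x = \sum_i sqmod ((Q *m x) i 0) /\
            q x = \sum_(i < n) s`_i * sqmod ((Q *m x) i 0).

(** A nonzero vector whose other n - 1 coordinates vanish exists for dimension
    reasons. *)
Lemma diagonal_value_attained n (Q : 'M[C]_n) s N q (i : 'I_n) :
  diagonalizes Q s N q -> exists2 x, x != 0 & q x = s`_i * N x.
Proof.
move=> D; have [x x0 Qx] : exists2 x : 'cV[C]_n, x != 0 & row' i Q *m x = 0.
  by apply: exists_annihilated; case: n i {Q D N q} => [[]|] //=.
exists x => //; have [-> ->] := D x.
rewrite mulr_sumr; apply: eq_bigr => j _.
case: (unliftP i j) => [j'|] -> //.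
have := congr1 (fun M : 'cV[C]__ => M j' 0) Qx; rewrite mul_rowsub_mx !mxE => ->.
by rewrite /sqmod /= expr0n addr0 !mulr0.
Qed.

(** The k conditions that kill the coordinates of [T *m x] below [k], the r
    conditions [L], and the n2 - (k + r + 1) conditions that kill the coordinates
    of [x] above [k + r] are n2 - 1 in number.  On a common nonzero solution,
    [N1] and [q1] see eigenvalues at least [s1`_k], and [N2] and [q2] see
    eigenvalues at most [s2`_(k + r)]. *)
Lemma minmax_comparison n1 n2 r (Q1 : 'M[C]_n1) (Q2 : 'M[C]_n2) s1 s2
    N1 q1 N2 q2 (T : 'M[C]_(n1, n2)) (L : 'M[C]_(r, n2)) k :
  diagonalizes Q1 s1 N1 q1 -> diagonalizes Q2 s2 N2 q2 ->
  sorted <=%O s1 -> sorted <=%O s2 -> size s1 = n1 -> size s2 = n2 ->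
  (forall x, x != 0 -> 0 < N1 (T *m x)) ->
  (forall x, L *m x = 0 -> q2 x <= s2`_(k + r) * N2 x ->
    q1 (T *m x) <= s2`_(k + r) * N1 (T *m x)) ->
  (k < n1)%N -> (k + r < n2)%N -> s1`_k <= s2`_(k + r).
Proof.
move=> D1 D2 sorted1 sorted2 sz1 sz2 N1_gt0 transfer kn1 krn2.
pose low (i : 'I_k) : 'I_n1 := widen_ord (ltnW kn1) i.
have high_lt (i : 'I_(n2 - (k + r).+1)) : ((k + r).+1 + i < n2)%N.
  by rewrite -ltn_subRL.
pose high i : 'I_n2 := Ordinal (high_lt i).
have [x x0] : exists2 x : 'cV[C]_n2, x != 0 &
    col_mx (rowsub low Q1 *m T) (col_mx L (rowsub high Q2)) *m x = 0.
  apply: exists_annihilated.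
  by move: krn2; lia.
rewrite !mul_col_mx -mulmxA !mul_rowsub_mx.
move=> /eqP; rewrite !col_mx_eq0 => /and3P[/eqP lowx /eqP Lx /eqP highx].
have [N1x q1x] := D1 (T *m x); have [N2x q2x] := D2 x.
have ub : q2 x <= s2`_(k + r) * N2 x.
  rewrite q2x N2x mulr_sumr; apply: ler_sum => i _.
  have [ik|ki] := leqP i (k + r).
    rewrite ler_wpM2r ?sqmod_ge0//.
    by apply: (sorted_leq_nth le_trans le_refl) => //; rewrite inE sz2.
  have il : (i - (k + r).+1 < n2 - (k + r).+1)%N by move: (ltn_ord i) ki; lia.
  have -> : i = high (Ordinal il) by apply: val_inj; rewrite /= subnKC.
  have := congr1 (fun M : 'cV[C]__ => M (Ordinal il) 0) highx; rewrite !mxE => ->.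
  by rewrite /sqmod /= expr0n addr0 !mulr0.
have lb : s1`_k * N1 (T *m x) <= q1 (T *m x).
  rewrite q1x N1x mulr_sumr; apply: ler_sum => i _.
  have [ki|ik] := leqP k i.
    rewrite ler_wpM2r ?sqmod_ge0//.
    by apply: (sorted_leq_nth le_trans le_refl) => //; rewrite inE sz1.
  have -> : i = low (Ordinal ik) by apply: val_inj.
  have := congr1 (fun M : 'cV[C]__ => M (Ordinal ik) 0) lowx; rewrite !mxE => ->.
  by rewrite /sqmod /= expr0n addr0 !mulr0.
by have := le_trans lb (transfer x Lx ub); rewrite ler_pM2r ?N1_gt0.
Qed.

End MinMax.

(** * The quadratic forms of a magnetic graph *)

Section Forms.
Variables (R : realType) (S : zmodClosed (angle R)).
Implicit Type G : mwgraph S.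
Local Notation C := R[i].

Definition mass G (f : vertex (mwG G) -> C) : R :=
  \sum_v wV (mwW G) v * sqmod (f v).

Definition jump G (f : vertex (mwG G) -> C) (e : edge (mwG G)) : C :=
  f (bdm e) - expi (pot (mwA G) e) * f (bdp e).

(** Both orientations of an edge contribute equally, whence the factor 1/2. *)
Definition energy G (f : vertex (mwG G) -> C) : R :=
  2^-1 * \sum_e wE (mwW G) e * sqmod (jump f e).

Lemma massE G (f : vertex (mwG G) -> C) : (mass f)%:C%C = inner_w f f.
Proof.
rewrite /mass /inner_w rmorph_sum; apply: eq_bigr => v _.
by rewrite rmorphM /= sqmodE.
Qed.

Lemma jump_ebar G (f : vertex (mwG G) -> C) e :
  jump f (ebar e) = - (expi (pot (mwA G) e))^* * jump f e.
Proof.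
rewrite /jump /bdm /bdp bd_ebar /= pot_ebar expiN mulrBr mulrA.
by rewrite !mulNr [_^* * expi _]mulrC expi_mul_conj mul1r opprK addrC.
Qed.

Lemma sqmod_jump_ebar G (f : vertex (mwG G) -> C) e :
  sqmod (jump f (ebar e)) = sqmod (jump f e).
Proof. by rewrite jump_ebar sqmodM sqmodN sqmod_conj sqmod_expi mul1r. Qed.

(** Summation by parts: adding to the sum over [e] its reindexing by [ebar]
    completes each term to a square. *)
Lemma energyE G (f : vertex (mwG G) -> C) :
  (energy f)%:C%C = inner_w (laplacian f) f.
Proof.
have -> : inner_w (laplacian f) f =
    \sum_e (wE (mwW G) e)%:C%C * (jump f e * (f (bdm e))^*).
  rewrite [RHS](partition_big (@bdm (mwG G)) xpredT)//=; apply: eq_bigr => v _.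
  rewrite mulrA laplacianE mulr_suml; apply: eq_bigr => e /eqP ev.
  by rewrite -mulrA /jump ev.
set T := \sum_e _.
have T2 : T + T = \sum_e (wE (mwW G) e * sqmod (jump f e))%:C%C.
  rewrite {2}/T (reindex_inj (can_inj (@ebarK (mwG G)))) -big_split /=.
  apply: eq_bigr => e _; rewrite wE_ebar rmorphM /= -mulrDr sqmodE.
  congr (_ * _); rewrite jump_ebar {4}/jump /bdm bd_ebar /= -/(bdp e).
  by rewrite rmorphB rmorphM /=; ring.
rewrite /energy rmorphM rmorph_sum /= -T2 -mulr2n -[T *+ 2]mulr_natl mulrA.
by rewrite fmorphV rmorph_nat mulVf ?mul1r ?pnatr_eq0.
Qed.

Lemma mass_gt0 G (f : vertex (mwG G) -> C) v : f v != 0 -> 0 < mass f.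
Proof.
move=> fv; rewrite /mass (bigD1 v)//= ltr_wpDr//.
  by apply: sumr_ge0 => u _; rewrite mulr_ge0 ?sqmod_ge0 ?ltW ?wV_gt0.
by rewrite mulr_gt0 ?wV_gt0// lt_def sqmod_ge0 sqmod_eq0 fv.
Qed.

Lemma energy_ge0 G (f : vertex (mwG G) -> C) : 0 <= energy f.
Proof.
rewrite mulr_ge0 ?invr_ge0// sumr_ge0// => e _.
by rewrite mulr_ge0 ?sqmod_ge0 ?ltW ?wE_gt0.
Qed.

Lemma max_rel_weight_ub (G : graph) (w : weight R G) v :
  \sum_(e | bdm e == v) wE w e <= max_rel_weight w * wV w v.
Proof.
rewrite -ler_pdivrMr ?wV_gt0// mulrC.
apply: ub_le_sup; last by exists v.
exists (\sum_u (wV w u)^-1 * \sum_(e | bdm e == u) wE w e) => _ [u _ <-].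
rewrite [leRHS](bigD1 u)//= lerDl sumr_ge0// => x _.
by rewrite mulr_ge0 ?invr_ge0 ?sumr_ge0 ?(ltW (wV_gt0 _ _))// => e _;
   rewrite ltW ?wE_gt0.
Qed.

(** From |a - b|^2 <= 2 (|a|^2 + |b|^2): after reversing edges, the second
    endpoints contribute as much as the first, and each vertex collects the
    weights of its edges. *)
Lemma energy_le_mass G (f : vertex (mwG G) -> C) :
  energy f <= 2 * max_rel_weight (mwW G) * mass f.
Proof.
have E1 : \sum_e wE (mwW G) e * sqmod (f (bdm e)) <=
    max_rel_weight (mwW G) * mass f.
  rewrite (partition_big (@bdm (mwG G)) xpredT)//= /mass mulr_sumr.
  apply: ler_sum => v _; rewrite mulrA.
  rewrite (eq_bigr (fun e => wE (mwW G) e * sqmod (f v))); last first.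
    by move=> e /eqP ->.
  by rewrite -mulr_suml ler_wpM2r ?sqmod_ge0 ?max_rel_weight_ub.
have E2 : \sum_e wE (mwW G) e * sqmod (f (bdp e)) =
    \sum_e wE (mwW G) e * sqmod (f (bdm e)).
  rewrite (reindex_inj (can_inj (@ebarK (mwG G))))/=.
  by apply: eq_bigr => e _; rewrite wE_ebar /bdp bd_ebar.
have E3 : \sum_e wE (mwW G) e * sqmod (jump f e) <=
    2 * (\sum_e wE (mwW G) e * sqmod (f (bdm e)) +
         \sum_e wE (mwW G) e * sqmod (f (bdp e))).
  rewrite -big_split mulr_sumr; apply: ler_sum => e _ /=.
  rewrite -mulrDr mulrCA ler_wpM2l ?(ltW (wE_gt0 _ _))//.
  apply: le_trans (sqmodB_le _ _) _.
  by rewrite sqmodM sqmod_expi mul1r.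
rewrite /energy; move: E1 E3; rewrite E2; lra.
Qed.

Lemma inner_w_conj G (f g : vertex (mwG G) -> C) :
  inner_w f g = (inner_w g f)^*.
Proof.
rewrite /inner_w rmorph_sum; apply: eq_bigr => v _.
rewrite !rmorphM /= conj_realc conjCK.
by congr (_ * _); rewrite mulrC.
Qed.

(** The bridge between [spectrum], which is defined by the roots of the
    characteristic polynomial, and the quadratic forms. *)
Lemma laplacian_diagonalization G :
  exists Q : 'M[C]_(order_mw G),
    diagonalizes Q (spectrum G)
      (fun x => mass (fun v : vertex (mwG G) => x (enum_rank v) 0))
      (fun x => energy (fun v : vertex (mwG G) => x (enum_rank v) 0)).
Proof.
set n := order_mw G; set L := laplacian_mx G.
pose d : 'rV[C]_n := \row_i (Num.sqrt (wV (mwW G) (enum_val i)))%:C%C.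
have d2 i : d 0 i ^+ 2 = (wV (mwW G) (enum_val i))%:C%C.
  by rewrite mxE -rmorphXn sqr_sqrtr// ltW ?wV_gt0.
have d_gt0 i : 0 < d 0 i.
  by rewrite mxE -[X in X < _]/((0 : R)%:C%C) ltcR sqrtr_gt0 wV_gt0.
pose f_ (x : 'cV[C]_n) (v : vertex (mwG G)) := x (enum_rank v) 0.
have sum_V (F : vertex (mwG G) -> C) : \sum_v F v = \sum_(i < n) F (enum_val i).
  by rewrite (reindex (@enum_val _ (vertex (mwG G))))//=; exact: onW_bij (enum_val_bij _).
have innerL x y : inner_w (laplacian (f_ x)) (f_ y) =
    \sum_i (y i 0)^* * (d 0 i ^+ 2 * (L *m x) i 0).
  rewrite /inner_w sum_V; apply: eq_bigr => i _.
  by rewrite d2 laplacian_mxE /f_ enum_valK mulrA mulrC.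
have sym i j : d 0 i ^+ 2 * L i j = (d 0 j ^+ 2 * L j i)^*.
  have entry k l : inner_w (laplacian (f_ (delta_mx l 0))) (f_ (delta_mx k 0)) =
      d 0 k ^+ 2 * L k l.
    rewrite innerL (bigD1 k)//= big1 ?addr0 => [|m /negPf mk].
      by rewrite -colE !mxE !eqxx conjC1 mul1r.
    by rewrite mxE mk conjC0 mul0r.
  by rewrite -!entry laplacian_self_adjoint inner_w_conj.
have [Q [sp [chQ QQ QspQ]]] := weighted_spectral d_gt0 sym.
have quad (sp' : 'rV[C]_n) x : \sum_i sp' 0 i * (sqmod ((Q *m x) i 0))%:C%C =
    (map_mx Num.conj x^T *m (map_mx Num.conj Q^T *m diag_mx sp' *m Q *m x)) 0 0.
  rewrite !mulmxA -map_mxM -trmx_mul -!mulmxA; move: (Q *m x) => y.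
  rewrite [RHS]mxE; apply: eq_bigr => i _.
  by rewrite mul_diag_mx !mxE sqmodE; ring.
have massQ x : mass (f_ x) = \sum_i sqmod ((Q *m x) i 0).
  apply: (@complexI R); rewrite massE rmorph_sum /=.
  transitivity (\sum_i (const_mx 1 : 'rV[C]_n) 0 i * (sqmod ((Q *m x) i 0))%:C%C).
    rewrite quad diag_const_mx mulmx1 QQ mul_diag_mx /inner_w sum_V [RHS]mxE.
    apply: eq_bigr => i _; rewrite !mxE -d2 /f_ enum_valK.
    by rewrite !mxE; ring.
  by apply: eq_bigr => i _; rewrite mxE mul1r.
have energyQ x : (energy (f_ x))%:C%C = \sum_i sp 0 i * (sqmod ((Q *m x) i 0))%:C%C.
  rewrite energyE quad QspQ innerL [RHS]mxE; apply: eq_bigr => i _.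
  by rewrite -mulmxA mul_diag_mx !mxE.
(* The spectral theorem lists the eigenvalues in some order; the rows of [Q] are
   permuted so as to follow the sorted list. *)
pose t := [tuple complex.Re (sp 0 i) | i < n].
have perm_sp : perm_eq (complex_spectrum G) [seq sp 0 i | i <- enum 'I_n].
  apply: prod_XsubC_eq; rewrite big_map big_enum/= -chQ.
  rewrite /complex_spectrum; case: closed_field_poly_normal => s /= {1}->.
  by rewrite (monicP (char_poly_monic _)) scale1r.
have sp_real i : sp 0 i = (complex.Re (sp 0 i))%:C%C.
  apply: (@complex_spectrum_real _ _ G); rewrite (perm_mem perm_sp).
  by apply: map_f; rewrite mem_enum.
have /tuple_permP[p sE] : perm_eq (spectrum G) t.
  rewrite /spectrum perm_sort (perm_trans (perm_map _ perm_sp))//.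
  by rewrite -map_comp.
exists (rowsub p Q) => x.
have QE i : (rowsub p Q *m x) i 0 = (Q *m x) (p i) 0.
  by rewrite mul_rowsub_mx mxE.
split; first by rewrite massQ (reindex_perm p); apply: eq_bigr => i _; rewrite QE.
apply: (@complexI R); rewrite energyQ (reindex_perm p) rmorph_sum.
apply: eq_bigr => i _; rewrite QE rmorphM /= sE.
by rewrite -[in RHS]tnth_nth !tnth_mktuple -sp_real.
Qed.

End Forms.

(** * Comparing the spectra of two graphs *)

Section Comparison.
Variables (R : realType) (S : zmodClosed (angle R)).
Implicit Types G H : mwgraph S.
Local Notation C := R[i].

Lemma spectrum_attained G mu : mu \in spectrum G ->
  exists2 f : vertex (mwG G) -> C, 0 < mass f & energy f = mu * mass f.
Proof.
case/(nthP 0) => i; rewrite size_spectrum => iG <-.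
have [Q D] := laplacian_diagonalization G.
have [x x0 xmu] := diagonal_value_attained (Ordinal iG) D.
exists (fun v => x (enum_rank v) 0) => //.
have /cV0Pn[j xj] := x0.
by apply: (@mass_gt0 _ _ G _ (enum_val j)); rewrite enum_valK.
Qed.

Lemma spectrum_ge0 G mu : mu \in spectrum G -> 0 <= mu.
Proof.
move=> /spectrum_attained[f f0 fmu].
by rewrite -(pmulr_lge0 _ f0) -fmu energy_ge0.
Qed.

Lemma spectrum_le_max_rel_weight G mu : mu \in spectrum G ->
  mu <= 2 * max_rel_weight (mwW G).
Proof.
move=> /spectrum_attained[f f0 fmu].
by rewrite -(ler_pM2r f0) -fmu energy_le_mass.
Qed.

(** The variational principle for the shifted preorder: functions on [H] are
    pulled back to [G] along [h], injectively because [h] is onto, and each of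
    the [r] linear conditions [c] costs one step in the order of the
    eigenvalues. *)
Lemma spec_le_of_forms G H r (h : vertex (mwG G) -> vertex (mwG H))
    (c : 'I_r -> vertex (mwG H) -> C) :
  (forall v', exists v, h v = v') ->
  (forall f mu, (forall i, \sum_v c i v * f v = 0) -> mu \in spectrum H ->
    energy f <= mu * mass f -> energy (f \o h) <= mu * mass (f \o h)) ->
  spec_le r G H.
Proof.
move=> h_surj transfer.
have le_order : (order_mw H <= order_mw G)%N.
  by have [g hg] := choice h_surj; exact: leq_card g (can_inj hg).
split; first by rewrite (leq_trans (leq_subr _ _)).
case=> // k /= kr.
have krH : (k + r < order_mw H)%N by move: kr; lia.
have kG : (k < order_mw G)%N by move: krH le_order; lia.
rewrite /lambda addSn /=.
have [Q1 D1] := laplacian_diagonalization G.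
have [Q2 D2] := laplacian_diagonalization H.
pose T : 'M[C]_(order_mw G, order_mw H) :=
  rowsub (fun i => enum_rank (h (enum_val i))) 1%:M.
pose L : 'M[C]_(r, order_mw H) := \matrix_(i, j) c i (enum_val j).
have TE x : (fun v => (T *m x) (enum_rank v) 0) =
    (fun v' => x (enum_rank v') 0) \o h.
  by apply/funext => v; rewrite mul_rowsub_mx mul1mx mxE enum_rankK.
apply: (minmax_comparison (T := T) (L := L) D1 D2) => //.
- exact: sort_le_sorted.
- exact: sort_le_sorted.
- exact: size_spectrum.
- exact: size_spectrum.
- move=> x /cV0Pn[j xj]; have [v hv] := h_surj (enum_val j).
  by rewrite TE; apply: (@mass_gt0 _ _ G _ v); rewrite /= hv enum_valK.
- move=> x Lx; rewrite TE; apply: transfer; last first.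
    by rewrite mem_nth ?size_spectrum.
  move=> i; transitivity ((L *m x) i 0); last by rewrite Lx mxE.
  rewrite mxE (reindex (@enum_val _ (vertex (mwG H))))/=; last first.
    exact: onW_bij (enum_val_bij _).
  by apply: eq_bigr => j _; rewrite enum_valK mxE.
Qed.

Lemma isospectral_of_spec_le G H : spec_le 0 G H -> spec_le 0 H G ->
  isospectral G H.
Proof.
rewrite /spec_le !subn0 => -[HG leGH] [GH leHG].
have GHeq : order_mw G = order_mw H by apply/eqP; rewrite eqn_leq GH HG.
apply: (@eq_from_nth _ 0) => [|k]; rewrite !size_spectrum// => kG.
apply/eqP; rewrite eq_le.
have := leGH k.+1; rewrite /lambda addn0 /= => ->; last by rewrite -GHeq.
by have := leHG k.+1; rewrite /lambda addn0 /= => ->.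
Qed.

End Comparison.

(** * Deleting an edge *)

Lemma expi0 (R : realType) : expi (0 : angle R) = 1.
Proof.
have <- : to_angle 0 = 0 :> angle R.
  by apply: (addrI (to_angle 0)); rewrite -to_angleD !addr0.
by rewrite expi_to_angle cos0 sin0.
Qed.

Lemma expi_pi (R : realType) : expi (to_angle (pi : R)) = -1.
Proof.
rewrite expi_to_angle cospi sinpi; apply/eqP.
by rewrite eq_complex /= oppr0 !eqxx.
Qed.

Section EdgeDeletion.
Variables (R : realType) (S : zmodClosed (angle R)).
Variables (G : graph) (a : potential S G) (w : weight R G).
Variables (e0 : edge G) (w' : weight R (del_edge e0)).
Local Notation C := R[i].
Local Notation mG := (MWGraph a w).
Local Notation mG' := (MWGraph (del_potential a e0) w').
Local Notation u := (bdm e0).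
Local Notation v := (bdp e0).
Local Notation z := (expi (pot a e0)).

Implicit Type f : vertex G -> C.

(** The deleted term has coefficient 1, not 1/2, since both orientations of [e0]
    disappear. *)
Lemma energy_del f : energy (G := mG) f =
  2^-1 * (\sum_(e : edge (del_edge e0))
            wE w (old_edge e) * sqmod (jump (G := mG) f (old_edge e))) +
  wE w e0 * sqmod (f u - z * f v).
Proof.
rewrite /energy /= (bigD1 e0)//= (bigD1 (ebar e0)) ?(eq_sym _ e0) ?ebar_neq//=.
rewrite sqmod_jump_ebar wE_ebar.
have -> : \sum_(e | (e != e0) && (e != ebar e0))
      wE w e * sqmod (jump (G := mG) f e) =
    \sum_(e in [pred e | e \notin [:: e0; ebar e0]])
      wE w e * sqmod (jump (G := mG) f e).
  by apply: eq_bigl => e; rewrite !inE negb_or.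
rewrite big_sub /jump /=; set A := \sum_(x : {x | _}) _.
by rewrite -[X in _ = 2^-1 * X + _]/A; lra.
Qed.

Lemma energy_del_le f :
  (forall e : edge (del_edge e0), wE w' e <= wE w (old_edge e)) ->
  energy (G := mG') f <= energy (G := mG) f - wE w e0 * sqmod (f u - z * f v).
Proof.
move=> w'w; rewrite energy_del addrK ler_wpM2l ?invr_ge0//.
by apply: ler_sum => e _; rewrite ler_wpM2r ?sqmod_ge0 ?w'w.
Qed.

Lemma energy_le_del f :
  (forall e : edge (del_edge e0), wE w (old_edge e) <= wE w' e) ->
  energy (G := mG) f <= energy (G := mG') f + wE w e0 * sqmod (f u - z * f v).
Proof.
move=> ww'; rewrite energy_del lerD2r ler_wpM2l ?invr_ge0//.
by apply: ler_sum => e _; rewrite ler_wpM2r ?sqmod_ge0 ?ww'.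
Qed.

Lemma mw_sub_del :
  (forall e : edge (del_edge e0), wE w' e <= wE w (old_edge e)) ->
  (forall x, wV w x <= wV w' x) -> mw_sub mG' mG.
Proof.
move=> w'w ww'; exists id, (@old_edge G e0); split => //= [x|e].
  by rewrite (big_pred1 x).
case: (boolP (e \in [:: e0; ebar e0])) => ee0.
  rewrite big1 ?ltW ?wE_gt0// => -[e1 e1P] /= /eqP ee1.
  by rewrite -ee1 (negPf e1P) in ee0.
by rewrite (big_pred1 (exist _ e ee0 : edge (del_edge e0))) ?w'w.
Qed.

Lemma spec_le_del :
  (forall e : edge (del_edge e0), wE w' e <= wE w (old_edge e)) ->
  (forall x, wV w x <= wV w' x) -> spec_le 0 mG' mG.
Proof.
move=> w'w ww'.
apply: (@spec_le_of_forms _ _ mG' mG 0 id (fun _ _ => 0)) => [x|f mu _ muG fmu].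
  by exists x.
have mu0 := spectrum_ge0 muG.
have le_mass : mass (G := mG) f <= mass (G := mG') f.
  by apply: ler_sum => x _; rewrite ler_wpM2r ?sqmod_ge0 ?ww'.
apply: le_trans (energy_del_le f w'w) _.
have := mulr_ge0 (ltW (wE_gt0 w e0)) (sqmod_ge0 (f u - z * f v)).
move: fmu (ler_wpM2l mu0 le_mass); rewrite /=; lra.
Qed.

(** With s = |f(u)|^2 = |f(v)|^2, the energy drops by at least 4 [wE w e0] s and
    the mass by at most 2 [wE w e0] s, so that mu <= 2 is exactly what makes up
    for the lost mass.  The [r] conditions [c] stand for any way of forcing
    antisymmetry: one condition in general, none on a loop with phase pi. *)
Lemma spec_le_del_antisym r (c : 'I_r -> vertex G -> C) :
  (forall f, (forall i, \sum_x c i x * f x = 0) -> f u = - (z * f v)) ->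
  (forall e : edge (del_edge e0), wE w' e <= wE w (old_edge e)) ->
  (forall x, x \notin [:: u; v] -> wV w x <= wV w' x) ->
  (forall x, x \in [:: u; v] -> wV w x - wE w e0 <= wV w' x) ->
  max_rel_weight w <= 1 -> spec_le r mG' mG.
Proof.
move=> c_antisym w'w ww' ww'0 rho1.
apply: (@spec_le_of_forms _ _ mG' mG r id c) => [x|f mu cf muG fmu].
  by exists x.
have fu := c_antisym f cf.
have mu2 : mu <= 2.
  by have := spectrum_le_max_rel_weight muG; move: rho1 => /=; lra.
have mu0 := spectrum_ge0 muG.
set s := sqmod (f u).
have sv : sqmod (f v) = s by rewrite /s fu sqmodN sqmodM sqmod_expi mul1r.
have jumpE : sqmod (f u - z * f v) = 4 * s.
  rewrite -(opprK (z * f v)) -fu /s.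
  by case: (f u) => x y; rewrite /sqmod /=; ring.
(* The sum ranges over the set of endpoints: one term for a loop. *)
have ends_le : \sum_(x | x \in [:: u; v]) sqmod (f x) <= 2 * s.
  rewrite big_mkcond (bigD1 u)//= !inE eqxx -/s.
  case: (eqVneq v u) => [vu|vu].
    rewrite big1 /= => [|x /negPf xu]; first by have : 0 <= s := sqmod_ge0 _; lra.
    by rewrite !inE vu xu.
  rewrite (bigD1 v)//= !inE eqxx orbT sv big1 /=; first by lra.
  by move=> x /andP[/negPf xu /negPf xv]; rewrite !inE xu xv.
have le_mass :
    mass (G := mG) f - wE w e0 * (2 * s) <= mass (G := mG') f.
  apply: (@le_trans _ _ (\sum_x (wV w x - (if x \in [:: u; v] then wE w e0 else 0))
      * sqmod (f x))).
    rewrite (eq_bigr (fun x => wV w x * sqmod (f x) -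
      (if x \in [:: u; v] then wE w e0 * sqmod (f x) else 0))); last first.
      by move=> x _; rewrite mulrBl; case: ifP; rewrite ?mul0r.
    rewrite sumrB lerD2l lerN2 -big_mkcond -mulr_sumr.
    by rewrite ler_wpM2l ?(ltW (wE_gt0 _ _)).
  apply: ler_sum => x _; rewrite ler_wpM2r ?sqmod_ge0//.
  by case: ifPn => [/ww'0|/ww'] //; rewrite subr0.
apply: le_trans (energy_del_le f w'w) _; rewrite jumpE.
have ws : 0 <= wE w e0 * s by rewrite mulr_ge0 ?sqmod_ge0 ?ltW ?wE_gt0.
move: fmu (ler_wpM2l mu0 le_mass); rewrite /=; nra.
Qed.

(** On the functions with f(u) = z f(v) the edge [e0] carries no energy.  One
    condition forces this in general, none on a loop with phase 0. *)
Lemma spec_le_del_sym r (c : 'I_r -> vertex G -> C) :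
  (forall f, (forall i, \sum_x c i x * f x = 0) -> f u = z * f v) ->
  (forall e : edge (del_edge e0), wE w (old_edge e) <= wE w' e) ->
  (forall x, wV w' x <= wV w x) -> spec_le r mG mG'.
Proof.
move=> c_sym ww' w'w.
apply: (@spec_le_of_forms _ _ mG mG' r id c) => [x|f mu cf muG fmu].
  by exists x.
have mu0 := spectrum_ge0 muG.
have le_mass : mass (G := mG') f <= mass (G := mG) f.
  by apply: ler_sum => x _; rewrite ler_wpM2r ?sqmod_ge0 ?w'w.
apply: le_trans (energy_le_del f ww') _.
rewrite (c_sym f cf) subrr -sqmodN oppr0 -[sqmod 0]/(0 ^+ 2 + 0 ^+ 2).
rewrite expr0n addr0 mulr0 addr0.
by apply: le_trans fmu _; rewrite ler_wpM2l.
Qed.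

Lemma endpoint_functional (y : C) f :
  \sum_x ((x == u)%:R - y * (x == v)%:R) * f x = f u - y * f v.
Proof.
have pick t : \sum_x (x == t)%:R * f x = f t.
  by rewrite (bigD1 t)//= eqxx mul1r big1 ?addr0// => x /negPf ->; rewrite mul0r.
under eq_bigr do rewrite mulrBl -mulrA.
by rewrite sumrB -mulr_sumr !pick.
Qed.

End EdgeDeletion.

Theorem theorem4p1 (R : realType) (S : zmodClosed (angle R))
    (G : graph) (a : potential S G) (w : weight R G)
    (e0 : edge G) (w' : weight R (del_edge e0)) :
  let mG : mwgraph S := MWGraph a w in
  let mG' : mwgraph S := MWGraph (del_potential a e0) w' in
  let ends : seq (vertex G) := [:: bdm e0; bdp e0] in
  [/\ (forall e : edge (del_edge e0), wE w' e <= wE w (old_edge e)) ->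
      (forall v : vertex G, v \notin ends -> wV w v <= wV w' v) ->
        ((forall v : vertex G, v \in ends -> wV w v <= wV w' v) ->
          mw_sub mG' mG /\ spec_le 0 mG' mG)
        /\
        ((forall v : vertex G, v \in ends -> wV w v - wE w e0 <= wV w' v) ->
         max_rel_weight w <= 1 ->
          spec_le 1 mG' mG
          /\ (is_loop e0 -> pot a e0 = to_angle pi -> spec_le 0 mG' mG)),
      (forall e : edge (del_edge e0), wE w (old_edge e) <= wE w' e) ->
      (forall v : vertex G, wV w' v <= wV w v) ->
        spec_le 1 mG mG'
        /\ (is_loop e0 -> pot a e0 = 0 -> spec_le 0 mG mG')
    & (forall e : edge (del_edge e0), wE w (old_edge e) = wE w' e) ->
      (forall v : vertex G, wV w' v = wV w v) ->
      is_loop e0 -> pot a e0 = 0 ->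
        [/\ spec_le 0 mG' mG, spec_le 0 mG mG' & isospectral mG mG']].
Proof.
move=> mG mG' ends.
have no_constraint : 'I_0 -> vertex G -> R[i] by move=> _ _; exact: 0.
have loop_sym f : is_loop e0 -> pot a e0 = 0 ->
    f (bdm e0) = expi (pot a e0) * f (bdp e0).
  by move=> -> ->; rewrite expi0 mul1r.
split.
- move=> w'w ww'; split=> [ww'0|ww'0 rho1].
    have ww'_all v : wV w v <= wV w' v.
      by case: (boolP (v \in ends)) => [/ww'0|/ww'].
    by split; [exact: mw_sub_del|exact: spec_le_del].
  split=> [|loop api].
    pose c (_ : 'I_1) x : R[i] :=
      (x == bdm e0)%:R - - expi (pot a e0) * (x == bdp e0)%:R.
    apply: (spec_le_del_antisym (c := c)) => // f /(_ ord0).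
    by rewrite endpoint_functional mulNr => /eqP; rewrite subr_eq0 => /eqP.
  apply: (spec_le_del_antisym (c := no_constraint)) => // f _.
  by rewrite loop api expi_pi mulN1r opprK.
- move=> ww' w'w; split=> [|loop a0].
    pose c (_ : 'I_1) x : R[i] :=
      (x == bdm e0)%:R - expi (pot a e0) * (x == bdp e0)%:R.
    apply: (spec_le_del_sym (c := c)) => // f /(_ ord0).
    by rewrite endpoint_functional => /eqP; rewrite subr_eq0 => /eqP.
  by apply: (spec_le_del_sym (c := no_constraint)) => // f _; exact: loop_sym.
- move=> ww' w'w loop a0.
  have le1 : spec_le 0 mG' mG by apply: spec_le_del => x; rewrite ?ww' ?w'w.
  have le2 : spec_le 0 mG mG'.
    apply: (spec_le_del_sym (c := no_constraint)) => [f _|x|x].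
    - exact: loop_sym.
    - by rewrite ww'.
    - by rewrite w'w.
  by split => //; exact: isospectral_of_spec_le.
Qed.
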